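(* Let $k$ be a field and let $A$ be a prime finitely presented monomial $k$-algebra. Then $A$ is either primitive or $A$ satisfies a polynomial identity.
   Context: Algebras are associative with unit. $k\{x_1,\ldots,x_d\}$ denotes the free associative (noncommutative polynomial) $k$-algebra on $x_1,\ldots,x_d$. A finitely generated $k$-algebra $A$ is a monomial algebra if $A\cong k\{x_1,\ldots,x_d\}/I$ for some two-sided ideal $I$ generated by monomials (words) in $x_1,\ldots,x_d$; it is a finitely presented monomial algebra if moreover $I$ is finitely generated as a two-sided ideal (equivalently, $I$ can be generated by finitely many monomials). A ring is left primitive if it has a faithful simple left module, right primitive if it has a faithful simple right module, and primitive if it is both left and right primitive. A $k$-algebra $A$ satisfies a polynomial identity if there is a nonzero noncommutative polynomial $p(x_1,\ldots,x_n)\in k\{x_1,\ldots,x_n\}$ such that $p(a_1,\ldots,a_n)=0$ for all $(a_1,\ldots,a_n)\in A^n$. *)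

(* Defs.v *)
From mathcomp Require Import all_boot all_order all_algebra.
From mathcomp.multinomials Require Export monalg.

Set Implicit Arguments.
Unset Strict Implicit.
Unset Printing Implicit Defensive.

Import GRing.Theory.

Local Open Scope ring_scope.

(* k{x_1, ..., x_d} is the monoid algebra of the free monoid on 'I_d; in it,
   the word w is the basis element << w >>. *)
Notation free_alg k d := {malg k[{fmonom 'I_d}]}.

Section Rings.
Variable R : pzRingType.

(* Closure under opposites follows from left multiplication by -1. *)
Definition two_sided_ideal (I : R -> Prop) : Prop :=
  [/\ I 0,
      forall x y, I x -> I y -> I (x + y),
      forall r x, I x -> I (r * x)
    & forall r x, I x -> I (x * r)].

Definition ideal_gen (S : R -> Prop) (x : R) : Prop :=
  forall I : R -> Prop,
    two_sided_ideal I -> (forall y, S y -> I y) -> I x.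

Definition fin_gen_ideal (I : R -> Prop) : Prop :=
  exists (n : nat) (g : 'I_n -> R),
    forall x, I x <-> ideal_gen (fun y => exists i, y = g i) x.

(* The product ideal I J is zero iff all products of an element of I by an
   element of J are. *)
Definition prime_ring : Prop :=
  (1 : R) <> 0 /\
  forall I J : R -> Prop, two_sided_ideal I -> two_sided_ideal J ->
    (forall x y, I x -> J y -> x * y = 0) ->
    (forall x, I x -> x = 0) \/ (forall y, J y -> y = 0).

Definition submodule (M : lmodType R) (N : M -> Prop) : Prop :=
  [/\ N 0,
      forall u v, N u -> N v -> N (u + v)
    & forall r u, N u -> N (r *: u)].

Definition simple_module (M : lmodType R) : Prop :=
  (exists u : M, u <> 0) /\
  forall N : M -> Prop, submodule N ->
    (forall u, N u -> u = 0) \/ (forall u, N u).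

Definition faithful_module (M : lmodType R) : Prop :=
  forall r : R, (forall u : M, r *: u = 0) -> r = 0.

Definition left_primitive : Prop :=
  exists M : lmodType R, simple_module M /\ faithful_module M.

End Rings.

(* Right R-modules are left modules over the converse ring R^c. *)
Definition right_primitive (R : pzRingType) : Prop := left_primitive R^c.

Definition primitive_ring (R : pzRingType) : Prop :=
  left_primitive R /\ right_primitive R.

Section Algebras.
Variable k : fieldType.

Definition monomial_ideal (d : nat) (I : free_alg k d -> Prop) : Prop :=
  exists W : {fmonom 'I_d} -> Prop,
    forall p, I p <-> ideal_gen (fun q => exists2 w, W w & q = << w >>) p.

(* A is isomorphic, as a k-algebra, to k{x_1, ..., x_d} / I: there is a
   surjective k-algebra morphism onto A with kernel I. *)
Definition presented_by (A : algType k) (d : nat)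
    (I : free_alg k d -> Prop) : Prop :=
  exists phi : {lrmorphism free_alg k d -> A},
    (forall a, exists p, phi p = a) /\ (forall p, phi p = 0 <-> I p).

Definition fp_monomial_algebra (A : algType k) : Prop :=
  exists (d : nat) (I : free_alg k d -> Prop),
    [/\ monomial_ideal I, fin_gen_ideal I & presented_by A I].

(* p(a_1, ..., a_n) *)
Definition nc_eval (A : algType k) (n : nat) (a : 'I_n -> A)
    (p : free_alg k n) : A :=
  mmap (in_alg A) (fun w : {fmonom 'I_n} => \prod_(i <- w) a i) p.

Definition satisfies_PI (A : algType k) : Prop :=
  exists (n : nat) (p : free_alg k n),
    p <> 0 /\ forall a : 'I_n -> A, nc_eval a p = 0.

End Algebras.

(* Main.v *)
From HB Require Import structures.
Require Import Defs.
From mathcomp Require Import finmap all_fingroup.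
From mathcomp Require Import all_boot all_order all_algebra.
From mathcomp Require Import zify boolp classical_sets.

Set Implicit Arguments.
Unset Strict Implicit.
Unset Printing Implicit Defensive.

Import GRing.Theory.

Local Open Scope ring_scope.

(* Call a word nonzero if its image in A is nonzero.  Finite presentation makes
   every long enough nonzero word w "cutting": if u w and w v are nonzero, so is
   u w v.  Fix such a w and look at the nonzero words having w as a prefix and as
   a suffix.

   If there is at most one of each length, A satisfies a standard identity.  All
   long nonzero words contain w, so a long word has the form p x q with x
   bordered by w and p, q taken from a finite set; two factors p x q and p x' q of
   a word can be exchanged, because the factor x q ... p x' between them is
   bordered by w and hence determined by its length.  By the pigeonhole principle
   the alternating sum over all orders of sufficiently many words vanishes.

   Otherwise there are w a <> w b of the same length, and a, b freely generate a
   monoid of words, which is used to write markers.  Let P be the set of words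
   that can be reduced to w by repeatedly replacing at the right end a marked
   word t_q = w a b^K c q c' w a b^n by w, where n encodes q, K, c, c'.  The
   reduction is unambiguous, so the linear form f that is 1 on P and 0 on the
   other words gives a proper left ideal {x | f (u x w) = 0 for all words u}
   comaximal with every nonzero two-sided ideal.  A maximal left ideal
   above it yields a faithful simple module.  Right primitivity follows by
   reversing words. *)

(** * Left primitivity from a comaximal left ideal *)

Section QuotientModule.
Variables (R : pzRingType) (M : lmodType R) (N : M -> Prop).
Hypothesis N_sub : submodule N.

Definition submodule_pred : {pred M} := fun u => `[< N u >].

Fact submodule_pred_zmod_closed : zmod_closed submodule_pred.
Proof.
have [N0 ND NZ] := N_sub; split; first exact/asboolP.
move=> u v /asboolP Nu /asboolP Nv; apply/asboolP/ND => //.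
by rewrite -scaleN1r; apply: NZ.
Qed.

HB.instance Definition _ :=
  GRing.isZmodClosed.Build M submodule_pred submodule_pred_zmod_closed.

Definition quotient_module := Quotient.quot submodule_pred.
HB.instance Definition _ := GRing.Zmodule.on quotient_module.

Definition quotient_class (u : M) : quotient_module := \pi_quotient_module%qT u.

Lemma quotient_classP (u v : M) :
  quotient_class u = quotient_class v <-> N (u - v).
Proof.
split=> [/eqP|Nuv].
  by rewrite -Quotient.idealrBE => /asboolP.
by apply/eqP; rewrite -Quotient.idealrBE; apply/asboolP.
Qed.

Lemma quotient_classD u v :
  quotient_class (u + v) = quotient_class u + quotient_class v.
Proof. exact: Quotient.pi_add. Qed.

Lemma quotient_class_surj (x : quotient_module) : exists u, quotient_class u = x.
Proof. by exists (repr x); exact: reprK. Qed.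

Definition quotient_scale (r : R) (x : quotient_module) : quotient_module :=
  quotient_class (r *: repr x).

Lemma quotient_scaleE r u :
  quotient_scale r (quotient_class u) = quotient_class (r *: u).
Proof.
have [_ _ NZ] := N_sub.
apply/quotient_classP; rewrite -scalerBr; apply: NZ.
by apply/quotient_classP; exact: reprK.
Qed.

Fact quotient_scaleA r s x :
  quotient_scale r (quotient_scale s x) = quotient_scale (r * s) x.
Proof.
have [u <-] := quotient_class_surj x.
by rewrite !quotient_scaleE scalerA.
Qed.

Fact quotient_scale1 : left_id 1 quotient_scale.
Proof.
by move=> x; have [u <-] := quotient_class_surj x; rewrite quotient_scaleE scale1r.
Qed.

Fact quotient_scaleDr : right_distributive quotient_scale +%R.
Proof.
move=> r x y; have [u <-] := quotient_class_surj x.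
have [v <-] := quotient_class_surj y.
by rewrite -quotient_classD !quotient_scaleE scalerDr quotient_classD.
Qed.

Fact quotient_scaleDl x : {morph quotient_scale^~ x : r s / r + s}.
Proof.
move=> r s; have [u <-] := quotient_class_surj x.
by rewrite !quotient_scaleE scalerDl quotient_classD.
Qed.

HB.instance Definition _ := GRing.Zmodule_isLmodule.Build R quotient_module
  quotient_scaleA quotient_scale1 quotient_scaleDr quotient_scaleDl.

Lemma quotient_classZ r u : quotient_class (r *: u) = r *: quotient_class u.
Proof. by rewrite -quotient_scaleE. Qed.

End QuotientModule.

Section Primitivity.
Variable R : pzRingType.

Definition left_ideal (L : R -> Prop) : Prop := submodule (M := R^o) L.

Lemma maximal_left_ideal (L : R -> Prop) : left_ideal L -> ~ L 1 ->
  exists H : R -> Prop, [/\ left_ideal H, forall x, L x -> H x, ~ H 1 &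
    forall H' : R -> Prop, left_ideal H' -> (forall x, H x -> H' x) -> ~ H' 1 ->
      forall x, H' x -> H x].
Proof.
move=> L_ideal L1.
(* The empty set is admitted so that the union of the empty chain is. *)
pose P (X : set R) := (exists x, X x) -> 
  [/\ left_ideal X, forall x, L x -> X x & ~ X 1].
have [F FP totF|H [PH Hmax]] := @Zorn_bigcup R P.
  have same x y : (\bigcup_(X in F) X)%classic x -> (\bigcup_(X in F) X)%classic y ->
      exists2 X, F X & X x /\ X y.
    move=> [X FX Xx] [Y FY Yy].
    by case: (totF X Y FX FY) => sXY; [exists Y|exists X] => //; split; auto.
  move=> [x0 [X0 FX0 X0x]].
  have [X0_ideal LX0 _] := FP _ FX0 (ex_intro _ _ X0x).
  split.
  - split; first by exists X0 => //; case: X0_ideal.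
    + move=> u v Uu Uv; have [X FX [Xu Xv]] := same _ _ Uu Uv.
      have [[_ XD _] _ _] := FP _ FX (ex_intro _ _ Xu).
      by exists X => //; apply: XD.
    + move=> r u [X FX Xu]; have [[_ _ XM] _ _] := FP _ FX (ex_intro _ _ Xu).
      by exists X => //; apply: XM.
  - by move=> x Lx; exists X0 => //; apply: LX0.
  - by move=> [X FX X1]; have [_ _] := FP _ FX (ex_intro _ _ X1); apply.
have H0 : exists x, H x.
  apply: contrapT => H0; apply: (Hmax L); last by move=> _; split.
  split; first by move=> x Hx; case: H0; exists x.
  by move=> sLH; case: H0; exists 0; apply: sLH; case: L_ideal.
have [H_ideal LH H1] := PH H0.
exists H; split=> // H' H'_ideal HH' H'1 x H'x.
apply: contrapT => Hx; apply: (Hmax H'); last first.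
  by move=> _; split=> // y Ly; apply/HH'/LH.
by split=> // sH; apply/Hx/sH.
Qed.

(** For a maximal left ideal [H] above [L], the module [R/H] is simple. Its annihilator is a
    two-sided ideal inside [H]; if nonzero, it would contain some [x] with [1 - x] in [L], which
    puts [1] in [H]. *)
Lemma left_primitive_of_comaximal (L : R -> Prop) : left_ideal L -> ~ L 1 ->
  (forall J : R -> Prop, two_sided_ideal J -> (exists2 x, J x & x <> 0) ->
    exists2 x, J x & L (1 - x)) ->
  left_primitive R.
Proof.
move=> L_ideal L1 comax.
have [H [H_ideal LH H1 Hmax]] := maximal_left_ideal L_ideal L1.
have [H_0 HD HM] := H_ideal.
pose cl := quotient_class H_ideal.
have cl0 u : cl u = 0 <-> H u.
  have cl00 : cl 0 = 0 by apply: (addIr (cl 0)); rewrite -quotient_classD !add0r.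
  by rewrite -{1}cl00 quotient_classP subr0.
exists (quotient_module H_ideal); split.
  split; first by exists (cl 1) => /cl0.
  move=> N [N0 ND NZ]; have [N_0|/existsNP[u /not_implyP[Nu u_neq0]]] :=
    pselect (forall u, N u -> u = 0); [by left|right].
  have Npre : left_ideal (fun x => N (cl x)).
    split; first by rewrite (proj2 (cl0 0)).
      by move=> x y Nx Ny; rewrite /cl quotient_classD; apply: ND.
    by move=> r x Nx; rewrite /cl quotient_classZ; apply: NZ.
  (* Otherwise maximality puts the preimage of [N] inside [H], although [N] contains [u], whose
     class is nonzero. *)
  have N1 : N (cl 1).
    apply: contrapT => N1; have [v uE] := quotient_class_surj u.
    apply: u_neq0; rewrite -uE; apply/cl0/(Hmax _ Npre) => //.
      by move=> x /cl0 ->.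
    by rewrite /cl uE.
  move=> v; have [x <-] := quotient_class_surj v.
  have xE : cl x = (x : R) *: cl 1.
    by rewrite -quotient_classZ; congr quotient_class; rewrite -[LHS]mulr1.
  by have := NZ x _ N1; rewrite -xE.
move=> r r0; apply: contrapT => r_neq0.
(* This ideal is the annihilator of [R/H]. *)
have [||x Jx Lx] := comax (fun r => forall u, H (r * u)).
- split=> [u|x y Hx Hy u|x y Hy u|x y Hy u].
  + by rewrite mul0r.
  + by rewrite mulrDl; apply: HD.
  + by rewrite -mulrA; apply: HM.
  + by rewrite -mulrA.
- exists r => // u; apply/cl0.
  by have -> : cl (r * u) = r *: cl u by [rewrite -quotient_classZ]; rewrite r0.
apply: H1; rewrite -(subrK x 1); apply: HD; first exact: LH.
by rewrite -[x]mulr1.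
Qed.

End Primitivity.

(** * Words with markers *)

Definition word_pow (T : Type) (b : seq T) (n : nat) : seq T := flatten (nseq n b).

Lemma word_powD (T : Type) (b : seq T) n p :
  word_pow b (n + p) = word_pow b n ++ word_pow b p.
Proof. by rewrite /word_pow nseqD flatten_cat. Qed.

Lemma word_powSr (T : Type) (b : seq T) n : word_pow b n.+1 = word_pow b n ++ b.
Proof. by rewrite -addn1 word_powD /word_pow /= cats0. Qed.

Lemma size_word_pow (T : Type) (b : seq T) n : size (word_pow b n) = (n * size b)%N.
Proof. by elim: n => //= n IHn; rewrite size_cat IHn mulSn. Qed.

Lemma nth_word_pow (T : Type) (x0 : T) b n j i : (j < n)%N -> (i < size b)%N ->
  nth x0 (word_pow b n) (j * size b + i) = nth x0 b i.
Proof.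
elim: n j => // n IHn [|j] lt_jn lt_ib; rewrite nth_cat ?lt_ib //.
by rewrite mulSn -addnA ltnNge leq_addr /= addKn IHn.
Qed.

Lemma cat_inj_suffix (T : eqType) (u u' v v' : seq T) :
  size v = size v' -> u ++ v = u' ++ v' -> u = u' /\ v = v'.
Proof.
move=> size_v E; have size_u : size u = size u'.
  by move/(congr1 size): E; rewrite !size_cat size_v => /addIn.
by move/eqP: E; rewrite eqseq_cat // => /andP[/eqP-> /eqP->].
Qed.

Section Languages.
Variables (T : countType) (nz : pred (seq T)).
Implicit Types (u v w q : seq T).

Definition factor_closed := forall u v v', nz (u ++ v ++ v') -> nz v.

Definition irreducible_language :=
  forall u v, nz u -> nz v -> exists r, nz (u ++ r ++ v).

Definition cutting w := forall u v, nz (u ++ w) -> nz (w ++ v) -> nz (u ++ w ++ v).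

Definition bordered w v := [&& nz v, prefix w v & suffix w v].

Hypothesis nz_factor : factor_closed.

Lemma nz_prefix u v : nz (u ++ v) -> nz u.
Proof. exact: (nz_factor (u := [::])). Qed.

Lemma nz_suffix u v : nz (u ++ v) -> nz v.
Proof. by move=> uv; apply: (@nz_factor u _ [::]); rewrite cats0. Qed.

(** Writing [w ++ a = y ++ w], the word becomes [y ++ w ++ b], which is glued along its middle [w].
    Hence extensions of [w] to bordered words are closed under concatenation. *)
Lemma bordered_cat w a b : cutting w ->
  bordered w (w ++ a) -> bordered w (w ++ b) -> bordered w (w ++ a ++ b).
Proof.
move=> cut_w /and3P[nza _ /suffixP[y yE]] /and3P[nzb _ /suffixP[z zE]].
apply/and3P; split; last 2 first.
- exact: prefix_prefix.
- by apply/suffixP; exists (y ++ z); rewrite catA yE -!catA zE.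
by rewrite catA yE -catA; apply: cut_w; rewrite // -yE.
Qed.

Lemma bordered_pow w b n : cutting w -> bordered w w ->
  bordered w (w ++ b) -> bordered w (w ++ word_pow b n).
Proof.
move=> cut_w ww wb; elim: n => [|n IHn]; first by rewrite cats0.
by rewrite /word_pow /=; apply: bordered_cat.
Qed.

Section Marks.
Variables (w a b : seq T).
Hypotheses (size_ab : size a = size b) (neq_ab : a <> b).

Let size_a_gt0 : (0 < size a)%N.
Proof.
by case: a b size_ab neq_ab => [|? ?] [|? ?].
Qed.

(** After cancelling the common trailing copies of [b], a surplus [b] on one side would face [a] on
    the other, and these have equal length. *)
Lemma marker_inj u u' n n' :
  u ++ a ++ word_pow b n = u' ++ a ++ word_pow b n' -> n = n' /\ u = u'.
Proof.
wlog le_nn' : u u' n n' / (n <= n')%N => [th E|].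
  have [le_nn'|/ltnW le_n'n] := leqP n n'; first exact: th.
  by have [] := th u' u n' n le_n'n (esym E).
rewrite -(subnK le_nn') word_powD; case: (n' - n)%N => [|p].
  by rewrite add0n => /cat_inj_suffix[] // ->.
by rewrite word_powSr !catA => /cat_inj_suffix[] // /cat_inj_suffix[].
Qed.

(* If [q] and [q'] had different sizes, [a ++ word_pow b K] would have the
   period [`|size q' - size q| <= K], and comparing its first block with the one
   at that index would give [a = b]. *)
Lemma tail_sizes_eq u u' c q q' K : (size q <= K)%N -> (size q' <= K)%N ->
  u ++ a ++ word_pow b K ++ c ++ q = u' ++ a ++ word_pow b K ++ c ++ q' ->
  size q = size q'.
Proof.
move=> le_qK le_q'K E.
wlog lt_qq' : u u' q q' le_qK le_q'K E / (size q < size q')%N => [th|].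
  have [lt_qq'|lt_q'q|//] := ltngtP (size q) (size q').
    exact: th E lt_qq'.
  by apply/esym/(th _ _ _ _ le_q'K le_qK (esym E)).
set r := a ++ word_pow b K ++ c; set D := (size q' - size q)%N.
have size_u : size u = (size u' + D)%N.
  by move/(congr1 size): E; rewrite !size_cat /D; lia.
case: a size_ab neq_ab size_a_gt0 @r E => // x0 a' size_ab' neq_ab' _ r E.
have period i : (i + D < size r)%N -> nth x0 r i = nth x0 r (i + D).
  move=> lt_ir; move/(congr1 (fun s => nth x0 s (size u + i))): E.
  have rE v t : v ++ (x0 :: a') ++ word_pow b K ++ c ++ t = v ++ r ++ t.
    by rewrite /r -!catA.
  rewrite !rE.
  rewrite !nth_cat.
  have -> : (size u + i < size u)%N = false by lia.
  have -> : (size u + i < size u')%N = false by lia.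
  have -> : (size u + i - size u = i)%N by lia.
  have -> : (size u + i - size u' = i + D)%N by lia.
  by rewrite lt_ir ifT //; lia.
have periodM i j : (i + j * D < size r)%N -> nth x0 r i = nth x0 r (i + j * D).
  elim: j => [|j IHj] lt_ir; first by rewrite mul0n addn0.
  have ijD : (i + j.+1 * D = i + j * D + D)%N by rewrite mulSn; lia.
  rewrite ijD in lt_ir *; rewrite -period // -IHj //.
  by move: lt_ir; lia.
have size_r : size r = (size b + (K * size b + size c))%N.
  by rewrite !size_cat size_ab' size_word_pow.
case: neq_ab'; apply: (@eq_from_nth _ x0) => // i lt_ia.
have Dpos : (0 < D)%N by rewrite subn_gt0.
have DK : (D <= K)%N by rewrite /D; lia.
have lt_ib : (i < size b)%N by rewrite -size_ab'.
have DKb : (D * size b <= K * size b)%N by rewrite leq_mul2r DK orbT.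
(* Shifting by [D] whole blocks moves index [i] from [a] into block [D.-1] of [word_pow b K], which
   exists because [D <= K]. *)
have := periodM i (size b); rewrite size_r (mulnC (size b)).
have -> : nth x0 r i = nth x0 (x0 :: a') i by rewrite nth_cat lt_ia.
move=> -> //; last by lia.
rewrite nth_cat size_ab'.
have Db : (D * size b = size b + D.-1 * size b)%N by rewrite -mulSn prednK.
have DKb' : (D.-1 * size b + size b <= K * size b)%N by rewrite addnC -Db.
have -> : (i + D * size b < size b)%N = false by rewrite Db addnCA -ltn_subRL subnn.
rewrite Db addnCA addKn addnC nth_cat size_word_pow.
have -> : (D.-1 * size b + i < K * size b)%N by lia.
by rewrite nth_word_pow // prednK.
Qed.

(* The number of trailing copies of [b] encodes the other parameters, so that
   they can be read off from the right end of a word. *)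
Definition mark q0 K c c' q :=
  w ++ a ++ word_pow b K ++ c ++ q ++ c' ++ w
    ++ a ++ word_pow b (pickle (q0, K, c, c')).

(** The trailing number gives back [(q0, K, c, c')]. Once [c' ++ w] is cancelled, the run
    [word_pow b K] forces [q] and [q0'] to have equal length, and the rest cancels from the right.
    On the left the slot may hold any [q], so a match with a genuine mark tests [q = q0]. *)
Lemma mark_inj u u' q0 q0' K K' c c1 c' c1' q :
  (size q <= K)%N -> (size q0' <= K')%N ->
  u ++ mark q0 K c c' q = u' ++ mark q0' K' c1 c1' q0' ->
  [/\ q0 = q0', q = q0' & u = u'].
Proof.
rewrite /mark => le_qK le_q0K E.
have {}E : (u ++ w ++ a ++ word_pow b K ++ c ++ q ++ c' ++ w)
      ++ a ++ word_pow b (pickle (q0, K, c, c'))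
    = (u' ++ w ++ a ++ word_pow b K' ++ c1 ++ q0' ++ c1' ++ w)
      ++ a ++ word_pow b (pickle (q0', K', c1, c1')) by rewrite -!catA.
have [/(pcan_inj (@pickleK _)) [-> eqK -> ->]] := marker_inj E.
rewrite -{}eqK in le_q0K * => {}E.
have {}E : ((u ++ w) ++ a ++ word_pow b K ++ c1 ++ q) ++ (c1' ++ w)
    = ((u' ++ w) ++ a ++ word_pow b K ++ c1 ++ q0') ++ (c1' ++ w) by rewrite -!catA.
have [{}E _] := cat_inj_suffix erefl E.
have size_q := tail_sizes_eq le_qK le_q0K E.
rewrite !catA in E; have [{}E ->] := cat_inj_suffix size_q E.
by do 4![have [{}E _] := cat_inj_suffix erefl E].
Qed.

Inductive marked : seq T -> Prop :=
| marked_base : marked w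
| marked_step u q K c c' : marked (u ++ w) -> nz (mark q K c c' q) ->
    (size q <= K)%N -> marked (u ++ mark q K c c' q).

Lemma marked_mark u q0 K c c' q : (size q <= K)%N ->
  marked (u ++ mark q0 K c c' q) -> q = q0 /\ marked (u ++ w).
Proof.
move=> le_qK; move vE: (u ++ _) => v mv.
case: mv vE => [|u' q' K' c1 c1' mu' _ le_q'K'] E.
  (* A mark contains [w] and the nonempty [a], so it is longer than [w]. *)
  by move/(congr1 size): E; rewrite !size_cat; lia.
by have [-> -> ->] := mark_inj le_qK le_q'K' E.
Qed.

Hypothesis cut_w : cutting w.

Lemma marked_nz v : nz w -> marked v -> nz v.
Proof.
move=> nzw; elim=> // u q K c c' _ nzu nzm _.
by apply: cut_w nzu _; apply: nzm.
Qed.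

End Marks.

(* The predicate [marked] makes the left ideal of all [x] with
   [lambda (u x w) = 0] for every word [u], where [lambda] is the linear form
   that is 1 on marked words and 0 on the others, comaximal with every nonzero
   two-sided ideal. *)
Lemma separating_contexts w x y : irreducible_language -> cutting w ->
  bordered w w -> bordered w x -> bordered w y -> size x = size y -> x <> y ->
  exists P : seq T -> Prop, [/\ P w, forall v, P v -> nz v &
    forall (q0 : seq T) (F : seq (seq T)), nz q0 -> q0 \in F ->
    exists l r, forall u q, q \in F ->
      P (u ++ l ++ q ++ r ++ w) <-> q = q0 /\ P (u ++ w)].
Proof.
move=> irr cut_w ww wx wy.
have /and3P[_ /prefixP[a xE] _] := wx; have /and3P[_ /prefixP[b yE] _] := wy.
subst x y; rewrite !size_cat => /addnI size_ab neq_ab.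
have {}neq_ab : a <> b by move=> E; rewrite E in neq_ab.
have nzw : nz w by case/and3P: ww.
exists (marked w a b); split; first exact: marked_base.
  by move=> v; apply: marked_nz.
move=> q0 F nzq0 q0F.
have [c nzc] := irr _ _ nzw nzq0.
have [c' nzc'] := irr _ _ nzc nzw.
pose K := \max_(q <- F) size q.
have le_FK q : q \in F -> (size q <= K)%N by move=> qF; apply: leq_bigmax_seq.
have wabn n : bordered w (w ++ a ++ word_pow b n).
  by apply: bordered_cat => //; apply: bordered_pow.
(* Here [K'] and [n'] are words: they are what remains of [w a b^K] and [w a b^n] when the final [w]
   is removed. The mark thus ends in [w], which the right context [r] leaves out. *)
have /and3P[nzK _ /suffixP[K' K'E]] := wabn K.
have /and3P[nzn _ /suffixP[n' n'E]] := wabn (pickle (q0, K, c, c')).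
have nzm : nz (mark w a b q0 K c c' q0).
  have nz1 : nz (K' ++ w ++ c ++ q0 ++ c' ++ w).
    by apply: cut_w; [rewrite -K'E|move: nzc'; rewrite -!catA].
  have -> : mark w a b q0 K c c' q0 = (K' ++ w ++ c ++ q0 ++ c')
      ++ w ++ a ++ word_pow b (pickle (q0, K, c, c')).
    by rewrite /mark !catA -K'E -!catA.
  by apply: cut_w => //; move: nz1; rewrite -!catA.
exists (w ++ a ++ word_pow b K ++ c), (c' ++ n') => u q qF.
have -> : u ++ (w ++ a ++ word_pow b K ++ c) ++ q ++ (c' ++ n') ++ w
    = u ++ mark w a b q0 K c c' q by rewrite /mark n'E -!catA.
split=> [|[-> mu]]; first by apply: marked_mark => //; apply: le_FK.
by apply: marked_step => //; apply: le_FK.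
Qed.

End Languages.

(** * Languages with at most one bordered word of each length *)

Lemma cat_split (T : Type) (u v u' v' : seq T) : (size u <= size u')%N ->
  u ++ v = u' ++ v' -> exists t, u' = u ++ t /\ v = t ++ v'.
Proof.
move=> le_uu' E; exists (drop (size u) u').
have uE : u = take (size u) u'.
  by move/(congr1 (take (size u))): E; rewrite take_size_cat // takel_cat.
have u'E : u' = u ++ drop (size u) u' by rewrite [X in X ++ _]uE cat_take_drop.
split=> //; move/(congr1 (drop (size u))): E; rewrite drop_size_cat // => ->.
by rewrite [in LHS]u'E -catA drop_size_cat.
Qed.

(** Since [w ++ v = y ++ w], the power has a copy of [w] at every multiple of [size v], and a window
    of length [size v + size w] contains a whole copy. *)
Lemma long_factor_of_power (T : eqType) (w v y : seq T) n p s t :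
  w ++ v = y ++ w -> (0 < size v)%N -> (size v + size w <= size s)%N ->
  w ++ word_pow v n = p ++ s ++ t -> exists p' t', s = p' ++ w ++ t'.
Proof.
move=> wv v_gt0 le_s; have size_y : size y = size v.
  by move/(congr1 size): wv; rewrite !size_cat => E; lia.
elim: n p => [|n IHn] p E.
  by move/(congr1 size): E; rewrite cats0 !size_cat; lia.
have {}E : y ++ w ++ word_pow v n = p ++ s ++ t.
  by rewrite -E /word_pow /= !catA wv.
have [le_yp|/ltnW lt_py] := leqP (size y) (size p).
  have [p' [_ {}E]] := cat_split le_yp E; exact: IHn E.
have [p' [yE {}E]] := cat_split lt_py (esym E).
have le_p's : (size (p' ++ w) <= size s)%N.
  by move: size_y; rewrite size_cat yE size_cat; lia.
have [t' [-> _]] := cat_split le_p's (etrans (esym (catA _ _ _)) (esym E)).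
by exists p', t'; rewrite catA.
Qed.

Lemma insub_bseq_inj (T : Type) n (s s' : seq T) :
  (size s <= n)%N -> (size s' <= n)%N -> insub_bseq n s = insub_bseq n s' -> s = s'.
Proof.
move=> le_s le_s' /(congr1 val).
by rewrite /insub_bseq !insubdK.
Qed.

Section UniquelyBordered.
Variables (T : finType) (nz : pred (seq T)) (w : seq T).
Hypotheses (nz_factor : factor_closed nz) (irr : irreducible_language nz).
Hypotheses (cut_w : cutting nz w) (nzw : nz w) (w_gt0 : (0 < size w)%N).
Hypothesis bordered_uniq :
  forall x y, bordered nz w x -> bordered nz w y -> size x = size y -> x = y.

Let ww : bordered nz w w.
Proof. by rewrite /bordered nzw prefix_refl suffix_refl. Qed.

Lemma bordered_return s : nz (w ++ s ++ w) -> bordered nz w (w ++ s ++ w).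
Proof. by move=> nzs; rewrite /bordered nzs prefix_prefix catA suffix_suffix. Qed.

(** Fix one return [v] from [w] to [w], and let [v'] be a return passing through [s]. The exponents
    [size v'] and [size v] make the two powers equally long, hence equal, so [s] is a factor of [w]
    followed by a power of [v]. *)
Lemma long_words_contain : exists n, forall s, nz s -> (n <= size s)%N ->
  exists p t, s = p ++ w ++ t.
Proof.
have [r0 nz0] := irr nzw nzw; set v := r0 ++ w.
exists (size v + size w)%N => s nzs le_s.
have [r nz1] := irr nzw nzs; have [r' nz2] := irr nz1 nzw.
have {nz1}nz2 : nz (w ++ (r ++ s ++ r') ++ w) by move: nz2; rewrite -!catA.
set v' := (r ++ s ++ r') ++ w in nz2.
have v_gt0 : (0 < size v)%N by rewrite size_cat addn_gt0 w_gt0 orbT.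
have /and3P[_ _ /suffixP[y yE]] := bordered_return nz0.
have E : w ++ word_pow v (size v') = w ++ word_pow v' (size v).
  apply: bordered_uniq.
  - by apply: bordered_pow => //; apply: bordered_return.
  - by apply: bordered_pow => //; apply: bordered_return.
  - by rewrite !(size_cat w) !size_word_pow mulnC.
apply: (long_factor_of_power yE v_gt0 le_s (n := size v') (p := w ++ r)
  (t := r' ++ w ++ word_pow v' (size v).-1)).
by rewrite E -{1}(prednK v_gt0) /word_pow /= /v' -!catA.
Qed.

(* The factors [x], [x'] are exchanged inside a single bordered factor. *)
Lemma swap_bordered p q x x' u1 u2 u3 : bordered nz w x -> bordered nz w x' ->
  nz (u1 ++ (p ++ x ++ q) ++ u2 ++ (p ++ x' ++ q) ++ u3) ->
  u1 ++ (p ++ x ++ q) ++ u2 ++ (p ++ x' ++ q) ++ u3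
    = u1 ++ (p ++ x' ++ q) ++ u2 ++ (p ++ x ++ q) ++ u3.
Proof.
move=> wx wx' nzu; have [z zE] : exists z, z = q ++ u2 ++ p by exists (q ++ u2 ++ p).
have /and3P[nzx /prefixP[a aE] /suffixP[b bE]] := wx.
have /and3P[nzx' /prefixP[a' a'E] /suffixP[b' b'E]] := wx'.
have nzxx' : nz (x ++ z ++ x').
  apply: (nz_factor (u := u1 ++ p) (v' := q ++ u3)).
  by move: nzu; rewrite zE -!catA.
(* Gluing [x'] on the left and [x] on the right of [w z w] shows that [x' z x] is nonzero as
   well. *)
have nzwzw : nz (w ++ z ++ w).
  apply: (nz_factor (u := b) (v' := a')).
  by move: nzxx'; rewrite bE a'E -!catA.
have nzx'z : nz (b' ++ w ++ z ++ w) by apply: cut_w; rewrite // -b'E.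
have nzx'x : nz ((b' ++ w ++ z) ++ w ++ a).
  by apply: cut_w; [rewrite -!catA|rewrite -aE].
suff E : x ++ z ++ x' = x' ++ z ++ x.
  by rewrite -!catA; congr (_ ++ _ ++ _); move/(congr1 (fun s => s ++ q ++ u3)): E;
    rewrite zE -!catA.
apply: bordered_uniq.
- apply/and3P; split=> //; first by rewrite aE -catA prefix_prefix.
  by rewrite b'E !catA suffix_suffix.
- apply/and3P; split; first by move: nzx'x; rewrite b'E aE -!catA.
    by rewrite a'E -catA prefix_prefix.
  by rewrite bE !catA suffix_suffix.
- by rewrite !size_cat; lia.
Qed.

(** A word of length at most [n + n] is its own class; a longer one is classified by its first and
    last [n] letters. These ends are disjoint and contain [w], so two long words of one class are
    [p x q] and [p x' q] with [x], [x'] bordered. *)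
Lemma finitely_many_swap_classes : exists (C : finType) (cl : seq T -> C),
  forall x x', nz x -> nz x' -> cl x = cl x' -> forall u1 u2 u3,
  nz (u1 ++ x ++ u2 ++ x' ++ u3) ->
  u1 ++ x ++ u2 ++ x' ++ u3 = u1 ++ x' ++ u2 ++ x ++ u3.
Proof.
have [n contain] := long_words_contain.
pose cl x : bool * {bseq (n + n) of T} := if (size x <= n + n)%N
  then (true, insub_bseq (n + n) x)
  else (false, insub_bseq (n + n) (take n x ++ drop (size x - n) x)).
exists _, cl => x x' nzx nzx'; rewrite /cl.
have [le_x|lt_x] := leqP (size x) _; have [le_x'|lt_x'] := leqP (size x') _ => //.
  by case=> /insub_bseq_inj-> //.
have size_ends (y : seq T) : (n + n < size y)%N ->
    (size (take n y) = n) * (size (drop (size y - n) y) = n).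
  by move=> lt_y; rewrite size_drop size_take; split; [case: ifP|]; lia.
case=> /insub_bseq_inj E.
have {E}/eqP : take n x ++ drop (size x - n) x = take n x' ++ drop (size x' - n) x'.
  by apply: E; rewrite size_cat !size_ends.
rewrite eqseq_cat ?size_ends // => /andP[/eqP eq_pre /eqP eq_suf].
have split3 (y : seq T) : (n + n < size y)%N ->
    exists m, y = take n y ++ m ++ drop (size y - n) y.
  move=> lt_y; exists (take (size y - n - n) (drop n y)).
  have -> : drop (size y - n) y = drop (size y - n - n) (drop n y).
    by rewrite drop_drop; congr drop; lia.
  by rewrite !cat_take_drop.
have [m xE] := split3 _ lt_x; have [m' x'E] := split3 _ lt_x'.
have nz_pre : nz (take n x) by move: nzx; rewrite {1}xE; exact: nz_prefix.
have nz_suf : nz (drop (size x - n) x).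
  by move: nzx; rewrite {1}xE catA; exact: nz_suffix.
have [|p [p' preE]] := contain _ nz_pre; first by rewrite size_ends.
have [|q' [q sufE]] := contain _ nz_suf; first by rewrite size_ends.
rewrite -eq_pre -eq_suf preE sufE in x'E; rewrite preE sufE in xE.
have {}xE : x = p ++ (w ++ (p' ++ m ++ q') ++ w) ++ q by rewrite xE -!catA.
have {}x'E : x' = p ++ (w ++ (p' ++ m' ++ q') ++ w) ++ q by rewrite x'E -!catA.
move=> u1 u2 u3; rewrite xE x'E; apply: swap_bordered; apply: bordered_return.
  by apply: (nz_factor (u := p) (v' := q)); rewrite -xE.
by apply: (nz_factor (u := p) (v' := q)); rewrite -x'E.
Qed.

End UniquelyBordered.

(** * Left primitivity of monomial algebras *)

(* [m] sends words to a ring [R] and [sc] is the scalar embedding; [R] is only a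
   ring so that the definition also applies to the converse of an algebra. The
   last condition says that the nonzero [m v] are linearly independent. *)
Definition monomial_basis (k : fieldType) (T : eqType) (R : pzRingType)
    (sc : k -> R) (m : seq T -> R) : Prop :=
  [/\ m [::] = 1,
      forall u v, m (u ++ v) = m u * m v,
      forall c x, sc c * x = x * sc c,
      forall x, exists (s : seq (seq T)) (c : seq T -> k),
        [/\ uniq s, forall v, v \in s -> m v <> 0 /\ c v <> 0
          & x = \sum_(v <- s) sc (c v) * m v]
    & forall g : seq T -> k, (forall v, m v = 0 -> g v = 0) ->
      exists f : R -> k, [/\ forall x y, f (x + y) = f x + f y,
        forall c x, f (sc c * x) = c * f x & forall v, f (m v) = g v]].

Section LeftPrimitivity.
Variables (k : fieldType) (T : countType) (R : pzRingType).
Variables (sc : k -> R) (m : seq T -> R).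
Hypothesis mP : monomial_basis sc m.

Let nz : pred (seq T) := fun v => m v != 0.

Lemma monomial_factor_closed : factor_closed nz.
Proof.
have [_ mM _ _ _] := mP.
move=> u v v'; apply: contra_neq => mv0.
by rewrite !mM mv0 mul0r mulr0.
Qed.

(** The contexts [l], [r] isolate one monomial [q0] of [z]: [f (u l z r w)] is [c q0] times
    [f (u w)]. So [l z r] divided by [c q0] is an element of [J] congruent to 1 modulo the left
    ideal. *)
Lemma left_primitive_of_bordered w x y : irreducible_language nz ->
  cutting nz w -> bordered nz w w -> bordered nz w x -> bordered nz w y ->
  size x = size y -> x <> y -> left_primitive R.
Proof.
move=> irr cut_w ww wx wy size_xy neq_xy.
have [m1 mM scC span indep] := mP.
have [P [Pw Pnz sep]] :=
  separating_contexts irr cut_w ww wx wy size_xy neq_xy.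
have scCA c z t : z * (sc c * t) = sc c * (z * t) by rewrite mulrA -scC mulrA.
have [|f [fD fZ fm]] := indep (fun v => (`[< P v >])%:R).
  by move=> v /eqP mv0; case: asboolP => // /Pnz /negP.
have f0 : f 0 = 0 by apply: (addrI (f 0)); rewrite -fD !addr0.
have fN z : f (- z) = - f z by apply: (addrI (f z)); rewrite -fD !subrr.
have fsum (I : eqType) (s : seq I) F : f (\sum_(i <- s) F i) = \sum_(i <- s) f (F i).
  by elim: s => [|i s IHs]; rewrite ?big_nil // !big_cons fD IHs.
apply: (@left_primitive_of_comaximal _ (fun z => forall u, f (m u * z * m w) = 0)).
- split=> [u|z t Lz Lt u|r z Lz u].
  + by rewrite mulr0 mul0r f0.
  + by rewrite mulrDr mulrDl fD Lz Lt addr0.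
  + rewrite (_ : r *: z = r * z) //.
    have [s [c [_ _ ->]]] := span r.
    rewrite mulr_suml mulr_sumr mulr_suml fsum big1 // => v _.
    by rewrite -!mulrA scCA fZ !mulrA -mM Lz mulr0.
- move/(_ [::])/eqP; by rewrite m1 !mul1r fm asboolT // oner_eq0.
move=> J [J0 JD Jl Jr] [z Jz z_neq0].
have [s [c [s_uniq snz zE]]] := span z.
case: s => [|q0 s] in s_uniq snz zE; first by rewrite big_nil in zE.
have [mq0 cq0] := snz q0 (mem_head _ _).
have [l [r lrP]] := sep q0 (q0 :: s) (introN eqP mq0) (mem_head _ _).
have fE u : f (m u * (m l * z * m r) * m w) = c q0 * (`[< P (u ++ w) >])%:R.
  rewrite zE !(mulr_sumr, mulr_suml) fsum (bigD1_seq q0) ?mem_head //= big1_seq.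
    rewrite addr0.
    have -> : m u * (m l * (sc (c q0) * m q0) * m r) * m w
        = sc (c q0) * m (u ++ l ++ q0 ++ r ++ w).
      by rewrite !mM -!mulrA !scCA.
    rewrite fZ fm; congr (_ * _%:R); congr nat_of_bool; apply/asbool_equiv_eq.
    by rewrite lrP ?mem_head //; split=> [[]|].
  move=> q /andP[q_neq qs].
  have -> : m u * (m l * (sc (c q) * m q) * m r) * m w
      = sc (c q) * m (u ++ l ++ q ++ r ++ w).
    by rewrite !mM -!mulrA !scCA.
  rewrite fZ fm asboolF ?mulr0 // => /(lrP u q qs)[eq_q _].
  by rewrite eq_q eqxx in q_neq.
exists (sc (c q0)^-1 * (m l * z * m r)); first by apply/Jl/Jr/Jl.
move=> u; rewrite mulrBr mulrBl fD fN mulr1 -mM fm.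
rewrite scCA -(mulrA (sc _)) fZ fE.
by rewrite mulrA mulVf ?mul1r ?subrr //; apply/eqP.
Qed.

End LeftPrimitivity.

(** * The standard identity *)

Section StandardIdentity.
Variables (k : fieldType) (T : eqType) (A : algType k) (m : seq T -> A).
Hypothesis mP : monomial_basis (in_alg A) m.
Variables (C : finType) (cl : seq T -> C).
Hypothesis clP : forall x x', m x <> 0 -> m x' <> 0 -> cl x = cl x' ->
  forall u1 u2 u3, m (u1 ++ x ++ u2 ++ x' ++ u3) = m (u1 ++ x' ++ u2 ++ x ++ u3).

Definition standard_poly n : free_alg k n :=
  \sum_(s : 'S_n) << (-1) ^+ s *g FMonom [seq s i | i <- enum 'I_n] >>.

Lemma standard_poly_neq0 n : standard_poly n <> 0.
Proof.
move/(congr1 (mcoeff (FMonom (enum 'I_n)))); rewrite raddf_sum mcoeff0 /=.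
rewrite (bigD1 1%g) //= big1 => [|s s_neq1].
  rewrite mcoeffU odd_perm1 (_ : [seq _ | i <- _] = enum 'I_n).
    by rewrite eqxx addr0 => /eqP; rewrite oner_eq0.
  by rewrite -[RHS]map_id; apply: eq_map => i; rewrite perm1.
rewrite mcoeffU; case: eqP => [[E]|//]; case/eqP: s_neq1.
apply/perm.permP => i; rewrite perm1.
have := congr1 (fun t => nth i t i) E.
by rewrite (nth_map i) ?size_enum_ord // nth_ord_enum.
Qed.

Lemma prod_tperm n (b : 'I_n -> seq T) i j l : uniq l -> i \in l -> j \in l ->
  i != j -> m (b i) <> 0 -> m (b j) <> 0 -> cl (b i) = cl (b j) ->
  m (flatten [seq b x | x <- l]) = m (flatten [seq b (tperm i j x) | x <- l]).
Proof.
(* The claim is symmetric in [i] and [j], so [i] may be assumed to come first in [l]. *)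
wlog: i j l / exists l1 l2 l3, l = l1 ++ i :: l2 ++ j :: l3 => [th|].
  move=> l_uniq il jl neq_ij nzi nzj cl_ij.
  case/splitPr: l / il l_uniq jl => l1 l2 l_uniq.
  rewrite mem_cat inE (eq_sym j) (negPf neq_ij) /= => /orP[jl|jl].
    case/splitPr: l1 / jl l_uniq => l1 l3 l_uniq.
    rewrite tpermC; apply: th; rewrite // ?mem_cat ?inE ?eqxx ?orbT //.
      by exists l1, l3, l2; rewrite -catA.
    by rewrite eq_sym.
  case/splitPr: l2 / jl l_uniq => l2 l3 l_uniq.
  apply: th; rewrite // ?mem_cat ?inE ?mem_cat ?inE ?eqxx ?orbT //.
  by exists l1, l2, l3.
move=> [l1 [l2 [l3 ->]]] l_uniq _ _ _ nzi nzj cl_ij.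
have fixl (t : seq 'I_n) : i \notin t -> j \notin t ->
    [seq b (tperm i j x) | x <- t] = [seq b x | x <- t].
  move=> it jt; apply/eq_in_map => x xt; congr b; apply: tpermD.
    by apply: contraNneq it => ->.
  by apply: contraNneq jt => ->.
have notin (x : 'I_n) t t' : uniq (t ++ x :: t') -> x \notin t ++ t'.
  by rewrite (perm_uniq (permEl (perm_catCA t [:: x] t'))) => /andP[].
have := notin _ _ _ l_uniq; have := notin j (l1 ++ i :: l2) l3.
rewrite -catA => /(_ l_uniq).
rewrite !(mem_cat, inE) !negb_or => /andP[/and3P[jl1 _ jl2] jl3].
move=> /and4P[il1 il2 _ il3].
do 2!rewrite !map_cat /=; rewrite !fixl // tpermL tpermR.
by do 2!rewrite !flatten_cat /=; apply: clP.
Qed.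

(** If some [b i] is zero in [A], every term vanishes; otherwise two of the words share a class, and
    exchanging them cancels the terms in pairs. *)
Lemma standard_words n (b : 'I_n -> seq T) : (#|C| < n)%N ->
  \sum_(s : 'S_n) (-1) ^+ s *: m (flatten [seq b (s i) | i <- enum 'I_n]) = 0.
Proof.
have [m1 mM _ _ _] := mP.
move=> lt_Cn; have [[i mi0]|nz_b] := pselect (exists i, m (b i) = 0).
  rewrite big1 // => s _.
  have : (s^-1)%g i \in enum 'I_n by rewrite mem_enum.
  case/path.splitPr => l1 l2.
  by rewrite map_cat /= permKV flatten_cat /= !mM mi0 mul0r mulr0 scaler0.
have [i [j [neq_ij cl_ij]]] : exists i j, i != j /\ cl (b i) = cl (b j).
  apply: contrapT => no; have : injective (cl \o b).
    by move=> i j /= E; apply/eqP; apply: contrapT => /negP neq; case: no; exists i, j.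
  by move/leq_card; rewrite card_ord leqNgt lt_Cn.
(* Multiplication by the transposition of [i] and [j] pairs terms of opposite
   signs. *)
pose t := tperm i j.
have oddMt s : (s * t)%g = ~~ s :> bool.
  by rewrite odd_permM odd_tperm neq_ij addbT.
rewrite (bigID (@odd_perm _)) /=; apply: canLR (subrK _) _; rewrite add0r -sumrN.
rewrite (reindex_inj (mulIg t)); apply: eq_big => //= s.
rewrite oddMt => /negPf->; rewrite expr1 expr0 scaleN1r scale1r; congr (- _).
have sl x : x \in [seq s i | i <- enum 'I_n].
  by apply/mapP; exists ((s^-1)%g x); rewrite ?mem_enum ?permKV.
have s_uniq : uniq [seq s i | i <- enum 'I_n].
  by rewrite map_inj_uniq ?enum_uniq //; apply: perm_inj.
have nzb x : m (b x) <> 0 by move=> mx0; apply: nz_b; exists x.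
have := prod_tperm s_uniq (sl i) (sl j) neq_ij (nzb i) (nzb j) cl_ij.
rewrite -!map_comp => ->; congr (m (flatten _)).
by apply: eq_map => x /=; rewrite permM.
Qed.

Lemma nc_eval_standard_poly n (a : 'I_n -> A) :
  nc_eval a (standard_poly n) = \sum_(s : 'S_n) (-1) ^+ s *: \prod_i a (s i).
Proof.
rewrite /nc_eval raddf_sum; apply: eq_bigr => s _ /=.
by rewrite mmapU /= mulr_algl big_map enumT [index_enum _]unlock.
Qed.

Lemma finite_expansion n (a : 'I_n -> A) : exists N (c : 'I_n -> 'I_N -> k) W,
  forall i, a i = \sum_(j < N) c i j *: m (W i j).
Proof.
have [_ _ _ span _] := mP.
have /fin_all_exists[s /fin_all_exists[c sP]] i : exists s (c : seq T -> k),
    a i = \sum_(v <- s) c v *: m v.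
  have [s [c [_ _ ->]]] := span (a i); exists s, c.
  by apply: eq_bigr => v _; rewrite mulr_algl.
pose N := \max_i size (s i).
exists N, (fun i j => if (j < size (s i))%N then c i (nth [::] (s i) j) else 0).
exists (fun i j => nth [::] (s i) j) => i.
rewrite sP (big_nth [::]) big_mkord.
pose F j := c i (nth [::] (s i) j) *: m (nth [::] (s i) j).
rewrite (big_ord_widen N F (leq_bigmax i)).
by rewrite big_mkcond; apply: eq_bigr => j _ /=; case: ifP; rewrite ?scale0r.
Qed.

Lemma satisfies_PI_of_swap_classes : satisfies_PI A.
Proof.
have [m1 mM _ _ _] := mP.
pose n := #|C|.+1.
exists n, (standard_poly n); split=> [|a]; first exact: standard_poly_neq0.
have [N [c [W aE]]] := finite_expansion a.
rewrite nc_eval_standard_poly.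
have prodE (s : 'S_n) : \prod_i a (s i) = \sum_(h : {ffun 'I_n -> 'I_N})
    (\prod_i c i (h i)) *: m (flatten [seq W (s i) (h (s i)) | i <- enum 'I_n]).
  rewrite (eq_bigr _ (fun i _ => aE (s i))) bigA_distr_bigA /=.
  (* Reindexing by [s] attaches the chosen summand to the element instead of its position, so the
     coefficient becomes independent of [s]. *)
  have inj_s : injective (fun h : {ffun 'I_n -> 'I_N} => [ffun i => h (s i)]).
    move=> h h' /ffunP E; apply/ffunP => i.
    by have := E ((s^-1)%g i); rewrite !ffunE permKV.
  rewrite (reindex_inj inj_s); apply: eq_bigr => h _.
  rewrite GRing.scaler_prod; congr (_ *: _).
    rewrite [RHS](reindex_inj (@perm_inj _ s)).
    by apply: eq_bigr => i _; rewrite ffunE.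
  rewrite [index_enum _]unlock -enumT.
  elim: (enum _) => [|i l IHl]; first by rewrite big_nil m1.
  by rewrite big_cons /= mM IHl ffunE.
under eq_bigr do rewrite prodE scaler_sumr.
rewrite exchange_big big1 // => h _ /=.
under eq_bigr do rewrite scalerA mulrC -scalerA.
by rewrite -scaler_sumr (standard_words (fun i => W i (h i))) ?scaler0.
Qed.

End StandardIdentity.

(** * Presented monomial algebras *)

(** Reversing words compensates for the opposite product of [R^c], and central scalars may stay on
    the left. *)
Lemma monomial_basis_converse (k : fieldType) (T : eqType) (R : pzRingType)
    (sc : k -> R) (m : seq T -> R) :
  monomial_basis sc m -> @monomial_basis k T R^c sc (m \o rev).
Proof.
move=> [m1 mM scC span indep]; split=> //=.
- by move=> u v; rewrite rev_cat mM.
- by move=> c x; rewrite [LHS](esym (scC c x)).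
- move=> x; have [s [c [s_uniq snz ->]]] := span x.
  exists (map rev s), (c \o rev); split.
  + by rewrite map_inj_uniq //; apply: inv_inj; apply: revK.
  + by move=> _ /mapP[v vs ->] /=; rewrite revK; apply: snz.
  + by rewrite big_map; apply: eq_bigr => v _ /=; rewrite !revK [LHS]scC.
- move=> g g0; have [|f [fD fZ fm]] := indep (g \o rev).
    by move=> v mv0 /=; apply: g0; rewrite revK.
  exists f; split=> // [c x|v]; last by rewrite fm /= revK.
  by rewrite -fZ [in RHS]scC.
Qed.

Section Reversal.
Variables (T : countType) (nz : pred (seq T)).
Let nzr : pred (seq T) := fun v => nz (rev v).

Lemma irreducible_language_rev : irreducible_language nz -> irreducible_language nzr.
Proof.
move=> irr u v nzu nzv; have [r nz_vru] := irr _ _ nzv nzu.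
by exists (rev r); rewrite /nzr !rev_cat revK -catA.
Qed.

Lemma cutting_rev w : cutting nz w -> cutting nzr (rev w).
Proof.
move=> cut_w u v; rewrite /nzr !rev_cat revK -catA => nzu nzv.
exact: cut_w.
Qed.

Lemma bordered_rev w v : bordered nz w v -> bordered nzr (rev w) (rev v).
Proof.
by move=> /and3P[? ? ?]; apply/and3P; rewrite /nzr revK prefix_rev suffix_rev.
Qed.

End Reversal.

Lemma ideal_gen_two_sided (R : pzRingType) (S : R -> Prop) :
  two_sided_ideal (ideal_gen S).
Proof.
split=> [J [] //|x y Sx Sy J J_id SJ|r x Sx J J_id SJ|r x Sx J J_id SJ].
- by have [_ JD _ _] := J_id; apply: JD; [apply: Sx|apply: Sy].
- by have [_ _ Jl _] := J_id; apply: Jl; apply: Sx.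
- by have [_ _ _ Jr] := J_id; apply: Jr; apply: Sx.
Qed.

Section Presentation.
Variables (k : fieldType) (d : nat) (I : free_alg k d -> Prop).
Hypotheses (I_mon : monomial_ideal I).

Let I_ideal : two_sided_ideal I.
Proof.
have [W IW] := I_mon.
have [J0 JD Jl Jr] := ideal_gen_two_sided
  (fun q : free_alg k d => exists2 w, W w & q = << w >>).
split=> [|x y|r x|r x]; rewrite !IW //; [exact: JD|exact: Jl|exact: Jr].
Qed.

Lemma malgUM (u v : {fmonom 'I_d}) :
  << (mmul u v) >> = << u >> * << v >> :> free_alg k d.
Proof. by rewrite malgM_def fgmulUU mulr1. Qed.

(** Provides the ideals against which membership in [ideal_gen] is tested to control supports. *)
Lemma span_two_sided (Z : {fmonom 'I_d} -> Prop) :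
  (forall u v, Z v -> Z (mmul u v)) -> (forall u v, Z u -> Z (mmul u v)) ->
  two_sided_ideal (fun p : free_alg k d => forall v, v \in msupp p -> Z v).
Proof.
move=> Zl Zr; split=> [v|p q Zp Zq v|r p Zp v|r p Zp v].
- by rewrite msupp0.
- by move/(fsubsetP (msuppD_le p q)); rewrite in_fsetU => /orP[/Zp|/Zq].
- by move=> /msuppM_le[u [u' [_ /Zp Zu' ->]]]; apply: Zl.
- by move=> /msuppM_le[u [u' [/Zp Zu _ ->]]]; apply: Zr.
Qed.

(** The polynomials whose support words all lie in [I] form a two-sided ideal containing the
    monomial generators. *)
Lemma monomial_ideal_msupp p : I p -> forall v, v \in msupp p -> I << v >>.
Proof.
have [W IW] := I_mon; have [_ _ Il Ir] := I_ideal.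
move=> /(proj1 (IW _)) genp.
apply: (genp (fun p => forall v, v \in msupp p -> I << v >>)).
  by apply: span_two_sided => u v Iv; rewrite malgUM; [apply: Il|apply: Ir].
move=> _ [w Ww ->] v; rewrite msuppU1 in_fset1 => /eqP ->.
by apply/IW => J _; apply; exists w.
Qed.


(** The finitely many generators need not be monomials, so [N] bounds all words in their supports. A
    word in [I] has such a support word [y] as a factor, and [y] itself lies in [I]. *)
Lemma monomial_ideal_cutting : fin_gen_ideal I -> exists N,
  forall u v w : {fmonom 'I_d}, (N <= size v)%N ->
  I << mmul (mmul u v) w >> -> I << mmul u v >> \/ I << mmul v w >>.
Proof.
move=> [n [g Ig]]; have [_ _ Il Ir] := I_ideal.
pose N := \max_(i < n) \max_(y <- msupp (g i)) size y; exists N => u v w le_Nv.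
pose Z (x : {fmonom 'I_d}) := exists (i : 'I_n) (y a b : {fmonom 'I_d}),
  y \in msupp (g i) /\ x = mmul (mmul a y) b.
move=> /Ig genuvw.
have {genuvw} := genuvw (fun p => forall v, v \in msupp p -> Z v).
case/(_ _ _ (mmul (mmul u v) w)).
- apply: span_two_sided => x x' [i [y [a [b [yg ->]]]]].
    by exists i, y, (mmul x a), b; rewrite !mulmA.
  by exists i, y, a, (mmul b x'); rewrite !mulmA.
- move=> _ [i ->] y yg; exists i, y, mone, mone.
  by rewrite mul1m mulm1.
- by rewrite msuppU1 in_fset1.
move=> i [y [a [b [yg E]]]].
have Iy : I << y >>.
  apply: monomial_ideal_msupp yg; apply/Ig => J _; apply; by exists i.
have le_yN : (size y <= N)%N.
  apply: leq_trans (leq_bigmax i); exact: leq_bigmax_seq.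
have {}E : u ++ v ++ w = a ++ y ++ b :> seq 'I_d.
  by move/(congr1 (@fmonom_val _)): E; rewrite !fmM -!catA.
have Ifactor (x s t : {fmonom 'I_d}) : x = s ++ y ++ t :> seq 'I_d -> I << x >>.
  move=> xE; have -> : x = mmul (mmul s y) t.
    by apply/eqP; rewrite fmP !fmM -catA xE.
  by rewrite !malgUM; apply/Ir/Il.
(* Being no longer than [v], the factor [y] ends within [u v] if it starts inside [u]; otherwise it
   lies in [v w]. *)
have [lt_au|le_ua] := ltnP (size a) (size u); [left|right].
  have {}E : a ++ y ++ b = (u ++ v) ++ w by rewrite -E catA.
  have le_ay : (size (a ++ y) <= size (u ++ v))%N by rewrite !size_cat; lia.
  rewrite catA in E; have [t [uvE _]] := cat_split le_ay E.
  by apply: (Ifactor _ a (FMonom t)); rewrite fmM uvE -catA.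
have [t [_ vwE]] := cat_split le_ua E.
by apply: (Ifactor _ (FMonom t) b); rewrite fmM vwE.
Qed.

End Presentation.

Section Quotient.
Variables (k : fieldType) (d : nat) (A : algType k) (I : free_alg k d -> Prop).
Variable phi : {lrmorphism free_alg k d -> A}.
Hypothesis I_mon : monomial_ideal I.
Hypothesis phi_surj : forall a, exists p, phi p = a.
Hypothesis phi_ker : forall p, phi p = 0 <-> I p.

Definition word_image (v : seq 'I_d) : A := phi << FMonom v >>.

Lemma monomial_basis_word_image : monomial_basis (in_alg A) word_image.
Proof.
have phiZ c p : phi (c *: p) = c *: phi p by rewrite linearZ.
have phiU c v : phi << c *g v >> = c *: word_image v.
  rewrite /word_image -phiZ fmK; congr (phi _).
  by apply/malgP => u; rewrite mcoeffZ !mcoeffU mulrnAr mulr1.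
split.
- by rewrite /word_image -(rmorph1 phi); congr (phi << _ >>); rewrite -fmoneE.
- move=> u v; rewrite /word_image -rmorphM -malgUM; congr (phi << _ >>).
  by apply/eqP; rewrite fmP fmM.
- by move=> c x; rewrite mulr_algl mulr_algr.
- move=> x; have [p <-] := phi_surj x.
  pose nz_supp := filter (fun v => word_image (fmonom_val v) != 0) (msupp p).
  exists (map (@fmonom_val _) nz_supp).
  exists (fun v => p@_(FMonom v)); split.
  + rewrite map_inj_uniq ?filter_uniq ?fset_uniq //.
    by move=> u v E; apply/eqP; rewrite fmP E.
  + move=> _ /mapP[v + ->]; rewrite mem_filter fmK => /andP[/eqP nzv].
    by rewrite -mcoeff_neq0 => /eqP.
  + rewrite {1}[p]monalgE raddf_sum big_map big_filter [RHS]big_mkcond.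
    apply: eq_bigr => v _ /=; rewrite phiU fmK mulr_algl.
    by case: eqP => // ->; rewrite scaler0.
move=> g g0; pose F := mmap (@idfun k) (fun v : {fmonom 'I_d} => g v).
have FB p q : F (p - q) = F p - F q by rewrite /F raddfB.
have FD p q : F (p + q) = F p + F q by rewrite /F raddfD.
have FZ c p : F (c *: p) = c * F p.
  rewrite /F (mmapEw (msuppZ_le _ _)) mmapE mulr_sumr.
  by apply: eq_bigr => v _; rewrite mcoeffZ mulrA.
(* The linear extension [F] of [g] vanishes on [I], whose elements are supported on words of zero
   image. Hence [F] descends to [A] through any choice of preimages. *)
have F_ker p : phi p = 0 -> F p = 0.
  move=> /phi_ker Ip; rewrite /F mmapE big_seq big1 // => v vp.
  rewrite g0 ?mulr0 // /word_image fmK; apply/phi_ker.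
  exact: (monomial_ideal_msupp I_mon Ip vp).
have [pre preK] := choice phi_surj.
have FE p : F (pre (phi p)) = F p.
  by apply/eqP; rewrite -subr_eq0 -FB F_ker // raddfB /= preK subrr.
exists (F \o pre); split=> [x y|c x|v] /=.
- by rewrite -{1}(preK x) -{1}(preK y) -(raddfD phi) FE FD.
- by rewrite mulr_algl -{1}(preK x) -phiZ FE FZ.
- by rewrite /word_image FE /F mmapU mul1r.
Qed.


Lemma cutting_word_image : fin_gen_ideal I -> exists N, forall v,
  (N <= size v)%N -> cutting (fun u => word_image u != 0) v.
Proof.
move=> /(monomial_ideal_cutting I_mon)[N cut_N]; exists N => v le_Nv u u' nzuv nzvu'.
have ker x : word_image x = 0 <-> I << FMonom x >> by exact: phi_ker.
apply/negP => /eqP/ker.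
have -> : FMonom (u ++ v ++ u') = mmul (mmul (FMonom u) (FMonom v)) (FMonom u').
  by apply/eqP; rewrite fmP !fmM /= catA.
case/(cut_N (FMonom u) (FMonom v) (FMonom u') le_Nv).
  have -> : mmul (FMonom u) (FMonom v) = FMonom (u ++ v).
    by apply/eqP; rewrite fmP !fmM.
  by move/ker/eqP; apply/negP.
have -> : mmul (FMonom v) (FMonom u') = FMonom (v ++ u').
  by apply/eqP; rewrite fmP !fmM.
by move/ker/eqP; apply/negP.
Qed.

End Quotient.

(** If [x R y = 0], then [x] lies in [I], the ideal of all [z] with [z R y = 0], and [y] lies in the
    right annihilator [J] of [I]; both ideals are nonzero with zero product. *)
Lemma prime_ring_mul (R : pzRingType) (x y : R) : prime_ring R ->
  x <> 0 -> y <> 0 -> exists r, x * r * y <> 0.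
Proof.
move=> [_ prime_R] x_neq0 y_neq0; apply: contrapT => no.
have xRy0 r : x * r * y = 0 by apply: contrapT => xry; apply: no; exists r.
pose I z := forall r, z * r * y = 0.
pose J t := forall z, I z -> z * t = 0.
have I_ideal : two_sided_ideal I.
  split=> [r|z t Iz It r|s z Iz r|s z Iz r].
  - by rewrite !mul0r.
  - by rewrite !mulrDl Iz It addr0.
  - by rewrite -!mulrA (mulrA z) Iz mulr0.
  - by rewrite -(mulrA z) Iz.
have [_ _ _ Ir] := I_ideal.
have J_ideal : two_sided_ideal J.
  split=> [z _|s t Js Jt z Iz|s t Jt z Iz|s t Jt z Iz].
  - by rewrite mulr0.
  - by rewrite mulrDr Js // Jt // addr0.
  - by rewrite mulrA Jt //; apply: Ir.
  - by rewrite mulrA Jt // mul0r.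
have [I0|J0] := prime_R I J I_ideal J_ideal (fun z t Iz Jt => Jt z Iz).
  exact/x_neq0/I0.
by apply/y_neq0/J0 => z Iz; have := Iz 1; rewrite mulr1.
Qed.

(** * The dichotomy for prime algebras with a monomial basis *)

Section Dichotomy.
Variables (k : fieldType) (T : finType) (A : algType k) (m : seq T -> A).
Hypotheses (A_prime : prime_ring A) (mP : monomial_basis (in_alg A) m).

Let nz : pred (seq T) := fun v => m v != 0.

Lemma irreducible_language_of_prime : irreducible_language nz.
Proof.
have [_ mM scC span _] := mP.
move=> u v /eqP nzu /eqP nzv.
have [r] := prime_ring_mul A_prime nzu nzv.
have [s [c [_ _ ->]]] := span r; move=> nz_sum; apply: contrapT => no.
apply: nz_sum; rewrite mulr_sumr mulr_suml big1 // => t _.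
rewrite mulrA -scC -!mulrA -!mM.
have -> : m (u ++ t ++ v) = 0; last by rewrite mulr0.
by apply: contrapT => /eqP nzutv; apply: no; exists t.
Qed.

Lemma primitive_of_bordered w x y : cutting nz w -> nz w ->
  bordered nz w x -> bordered nz w y -> size x = size y -> x <> y ->
  primitive_ring A.
Proof.
have irr := irreducible_language_of_prime.
move=> cut_w nzw wx wy size_xy neq_xy.
have ww : bordered nz w w by rewrite /bordered nzw prefix_refl suffix_refl.
split; first exact: (left_primitive_of_bordered mP irr cut_w ww wx wy).
apply: (left_primitive_of_bordered (monomial_basis_converse mP)
  (irreducible_language_rev irr) (cutting_rev cut_w)
  (bordered_rev ww) (bordered_rev wx) (bordered_rev wy)).
- by rewrite !size_rev.
- by move/(can_inj revK).
Qed.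

Lemma primitive_or_PI N :
  (forall v, (N <= size v)%N -> cutting nz v) ->
  primitive_ring A \/ satisfies_PI A.
Proof.
move=> cutN; have [prim|not_prim] := pselect (primitive_ring A); [by left|right].
suff [C [cl clP]] : exists (C : finType) (cl : seq T -> C),
    forall x x', nz x -> nz x' -> cl x = cl x' -> forall u1 u2 u3,
    nz (u1 ++ x ++ u2 ++ x' ++ u3) ->
    u1 ++ x ++ u2 ++ x' ++ u3 = u1 ++ x' ++ u2 ++ x ++ u3.
  (* The swap is known only for nonzero words: it applies from whichever side is nonzero, and
     otherwise both images are 0. *)
  apply: (@satisfies_PI_of_swap_classes _ _ _ m mP C cl) =>
    x x' /eqP nzx /eqP nzx' cl_xx' u1 u2 u3.
  have [E|nzE] := eqVneq (m (u1 ++ x ++ u2 ++ x' ++ u3)) 0; last first.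
    by rewrite (clP x x').
  have [E'|nzE'] := eqVneq (m (u1 ++ x' ++ u2 ++ x ++ u3)) 0; first by rewrite E.
  by rewrite (clP x' x).
have [[w [nzw le_Nw w_gt0]]|short] :=
    pselect (exists w, [/\ nz w, (N <= size w)%N & (0 < size w)%N]).
  apply: (finitely_many_swap_classes (w := w)) => //.
  - exact: monomial_factor_closed mP.
  - exact: irreducible_language_of_prime.
  - exact: cutN.
  - move=> x y wx wy size_xy; apply: contrapT => neq_xy; apply: not_prim.
    exact: (primitive_of_bordered (cutN _ le_Nw) nzw wx wy).
(* Without such a [w], nonzero words have bounded length, so each can be its own class. *)
have short_nz x : nz x -> (size x <= N)%N.
  move=> nzx; rewrite leqNgt; apply/negP => lt_Nx; apply: short.
  by exists x; split=> //; [apply: ltnW|apply: leq_ltn_trans lt_Nx].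
exists _, (@insub_bseq N T) => x x' /short_nz le_x /short_nz le_x'.
by move=> /(insub_bseq_inj le_x le_x') ->.
Qed.

End Dichotomy.

Theorem theorem1p2 (k : fieldType) (A : algType k)
    (A_prime : prime_ring A) (A_fpm : fp_monomial_algebra A) :
  primitive_ring A \/ satisfies_PI A.
Proof.
have [d [I [I_mon I_fg [phi [phi_surj phi_ker]]]]] := A_fpm.
have [N cutN] := cutting_word_image I_mon phi_ker I_fg.
exact: (primitive_or_PI A_prime
  (monomial_basis_word_image I_mon phi_surj phi_ker) cutN).
Qed.
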